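(* Let $\mathcal{X}$ be an infinite-dimensional type $1$ normed space over $\mathbb{F}$ and let $T\in\mathcal{B}[\mathcal{X}]$. Suppose that (a) $T$ is power bounded, (b) $y\in\mathcal{X}$ is a weakly l-sequentially supercyclic vector for $T$, and (c) $y$ is not a supercyclic vector for $T$. Then (d) every nonzero $f\in\mathcal{X}^*$ is such that either (d$_1$) $\liminf_n|f(T^ny)|=0$, or (d$_2$) $\limsup_k|f(T^{n_k}y)|<\|f\|\,\limsup_k\|T^{n_k}y\|$ for some subsequence $\{T^{n_k}\}_{k\ge0}$ of $\{T^n\}_{n\ge0}$.
   Context: $\mathbb{F}$ is either $\mathbb{R}$ or $\mathbb{C}$. $\mathcal{B}[\mathcal{X}]$ is the normed algebra of all operators (bounded linear maps) of $\mathcal{X}$ into itself, and $\mathcal{X}^*$ is the dual of $\mathcal{X}$. $T$ is power bounded if $\sup_{n\ge0}\|T^n\|<\infty$. A normed space $\mathcal{X}$ is of type $1$ (a Radon–Riesz space) if, for every $\mathcal{X}$-valued sequence $\{x_k\}_{k\ge0}$ and every $x\in\mathcal{X}$, $x_k\to x$ in norm if and only if $x_k\to x$ weakly and $\|x_k\|\to\|x\|$. A vector $y\in\mathcal{X}$ is a supercyclic vector for $T$ if its projective orbit $\{\alpha T^ny:\alpha\in\mathbb{F},\,n\ge0\}$ is dense in $\mathcal{X}$ in the norm topology. A nonzero vector $y\in\mathcal{X}$ is a weakly l-sequentially supercyclic vector for $T$ if for every $x\in\mathcal{X}$ there exist a sequence $\{\alpha_k\}_{k\ge0}$ of nonzero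 numbers in $\mathbb{F}$ and a subsequence $\{T^{n_k}\}_{k\ge0}$ of $\{T^n\}_{n\ge0}$ (both depending on $x$ and $y$) such that $\alpha_kT^{n_k}y$ converges weakly to $x$. *)

(* Defs.v *)
From Stdlib Require Import Reals.
From Coquelicot Require Import Coquelicot.

Open Scope R_scope.

Set Implicit Arguments.
Unset Strict Implicit.

Definition real_or_complex (F : AbsRing) : Prop :=
  F = R_AbsRing \/ F = C_AbsRing.

(* [sum_n _ n] has the n+1 terms 0, ..., n; padding a finite spanning family
   with zero vectors makes this harmless, including for the zero space. *)
Definition finite_dimensional {F : AbsRing} (X : NormedModule F) : Prop :=
  exists (n : nat) (e : nat -> X), forall x : X,
    exists c : nat -> F, x = sum_n (fun i => scal (c i) (e i)) n.

Definition infinite_dimensional {F : AbsRing} (X : NormedModule F) : Prop :=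
  ~ finite_dimensional X.

(* Coquelicot's [is_linear] includes boundedness, so it already describes
   bounded linear operators and, with values in the scalars, the dual. *)
Definition is_bounded_operator {F : AbsRing} {X : NormedModule F}
    (T : X -> X) : Prop :=
  is_linear T.

Definition in_dual {F : AbsRing} {X : NormedModule F} (f : X -> F) : Prop :=
  is_linear (V := AbsRing_NormedModule F) f.

Definition op_norm {F : AbsRing} {X Y : NormedModule F} (L : X -> Y) : Rbar :=
  Lub_Rbar (fun r : R => exists x : X, norm x <= 1 /\ r = norm (L x)).

Definition dual_norm {F : AbsRing} {X : NormedModule F} (f : X -> F) : Rbar :=
  op_norm (Y := AbsRing_NormedModule F) f.

Definition power {X : Type} (T : X -> X) (n : nat) : X -> X :=
  fun x => Nat.iter n T x.

Definition power_bounded {F : AbsRing} {X : NormedModule F}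
    (T : X -> X) : Prop :=
  Rbar_lt (Sup_seq (fun n => op_norm (power T n))) p_infty.

Definition norm_converges {F : AbsRing} {X : NormedModule F}
    (u : nat -> X) (x : X) : Prop :=
  filterlim u eventually (locally x).

Definition weakly_converges {F : AbsRing} {X : NormedModule F}
    (u : nat -> X) (x : X) : Prop :=
  forall f : X -> F, in_dual f ->
    filterlim (fun k => f (u k)) eventually (locally (f x)).

Definition type1 {F : AbsRing} (X : NormedModule F) : Prop :=
  forall (u : nat -> X) (x : X),
    norm_converges u x <->
    (weakly_converges u x /\ is_lim_seq (fun k => norm (u k)) (norm x)).

Definition norm_dense {F : AbsRing} {X : NormedModule F}
    (D : X -> Prop) : Prop :=
  forall (x : X) (eps : posreal), exists z : X, D z /\ ball_norm x eps z.

Definition projective_orbit {F : AbsRing} {X : NormedModule F}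
    (T : X -> X) (y : X) : X -> Prop :=
  fun z => exists (alpha : F) (n : nat), z = scal alpha (power T n y).

Definition supercyclic_vector {F : AbsRing} {X : NormedModule F}
    (T : X -> X) (y : X) : Prop :=
  norm_dense (projective_orbit T y).

(* Index map of a subsequence. *)
Definition strictly_increasing (s : nat -> nat) : Prop :=
  forall k : nat, (s k < s (S k))%nat.

Definition weakly_l_sequentially_supercyclic_vector
    {F : AbsRing} {X : NormedModule F} (T : X -> X) (y : X) : Prop :=
  y <> zero /\
  forall x : X, exists (alpha : nat -> F) (s : nat -> nat),
    (forall k, alpha k <> zero) /\
    strictly_increasing s /\
    weakly_converges (fun k => scal (alpha k) (power T (s k) y)) x.

(* Main.v *)
Require Import Defs.
From Stdlib Require Import Reals.
From Stdlib Require Import Lra Lia Classical IndefiniteDescription.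
From Coquelicot Require Import Coquelicot.

Open Scope R_scope.

(** Suppose that both alternatives fail for [f].  The failure of the first keeps
    [|f(T^n y)|] eventually above some [c > 0]; the failure of the second says
    that along no subsequence is the bound [|f(T^n y)| <= ||f|| ||T^n y||]
    strict in the limit.  It then follows that [y] is supercyclic.

    Fix [x] and let [alpha_k T^(n_k) y] converge weakly to [x].  Power
    boundedness allows one to pass to a subsequence along which [||T^(n_k) y||]
    tends to some [b] and [|f(T^(n_k) y)|] to some [L].  Then [L >= c > 0] and
    [L = ||f|| b].  As [|alpha_k| |f(T^(n_k) y)|] tends to [|f(x)|], the scalars
    [|alpha_k|] tend to [|f(x)| / L], whence
    [||alpha_k T^(n_k) y|| -> |f(x)| b / L = |f(x)| / ||f|| <= ||x||].

    It remains to see that in a Radon-Riesz space a sequence converging weakly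
    to [x], with norms converging to some [r <= ||x||], converges to [x] in norm
    ([type1_norm_converges]).  The expected reason is that the norm is weakly
    lower semicontinuous, which forces [r = ||x||], but that rests on the
    Hahn-Banach theorem.  The Radon-Riesz property itself gives a direct
    argument: if [r < ||x||], stretching [u_k - x] by a factor in a fixed
    interval [[1, M]] gives a sequence with the same weak limit and with norms
    exactly [||x||] that stays away from [x]. *)

(** * Scalars and norms *)

(** Real multiples suffice for normalising vectors and for moving along
    segments, so a copy of the real line inside the scalars lets the real and
    the complex case be treated together. *)
Definition real_line_embedding (F : AbsRing) (iota : R -> F) : Prop :=
  iota 1 = one /\
  (forall r s, iota (r - s) = minus (iota r) (iota s)) /\
  (forall r, abs (iota r) = Rabs r).

Lemma real_line_embedding_exists (F : AbsRing) (hF : real_or_complex F) :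
  exists iota : R -> F, real_line_embedding F iota.
Proof.
destruct hF as [-> | ->].
- now exists (fun r => r).
- exists RtoC; repeat split.
  + intros r s; apply (RtoC_minus r s).
  + intros r; apply Cmod_R.
Qed.

Lemma abs_inverse_exists (F : AbsRing) (hF : real_or_complex F) (a : F) :
  a <> zero -> exists b : F, mult b a = one /\ abs b * abs a = 1.
Proof.
destruct hF as [-> | ->]; intros ha.
- exists (/ a); assert (ha' : a <> 0) by exact ha; split.
  + now apply Rinv_l.
  + change (Rabs (/ a) * Rabs a = 1).
    now rewrite <- Rabs_mult, Rinv_l, Rabs_R1.
- assert (ha' : a <> RtoC 0) by exact ha.
  exists (Cinv a); split.
  + now apply Cinv_l.
  + change (Cmod (/ a) * Cmod a = 1).
    now rewrite <- Cmod_mult, Cinv_l, Cmod_1.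
Qed.

Lemma minus_plus_plus_l (G : AbelianGroup) (x a b : G) :
  minus (plus x a) (plus x b) = minus a b.
Proof.
unfold minus.
rewrite opp_plus, (plus_comm x), <- plus_assoc, (plus_assoc x).
now rewrite plus_opp_r, plus_zero_l.
Qed.

Lemma minus_plus_l (G : AbelianGroup) (x a : G) : minus (plus x a) x = a.
Proof.
change (plus (plus x a) (opp x) = a).
now rewrite (plus_comm x), <- plus_assoc, plus_opp_r, plus_zero_r.
Qed.

Lemma plus_minus_r (G : AbelianGroup) (x a : G) : plus x (minus a x) = a.
Proof.
change (plus x (plus a (opp x)) = a).
now rewrite (plus_comm a), plus_assoc, plus_opp_r, plus_zero_l.
Qed.

(** Normed modules only postulate [<=]; equality comes from dividing by [a]. *)
Lemma norm_scal_eq (F : AbsRing) (hF : real_or_complex F) (X : NormedModule F)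
    (a : F) (x : X) : norm (scal a x) = abs a * norm x.
Proof.
apply Rle_antisym; [apply norm_scal|].
destruct (classic (a = zero)) as [-> | ha].
- rewrite abs_zero, Rmult_0_l; apply norm_ge_0.
- destruct (abs_inverse_exists F hF a ha) as [b [hba hab]].
  assert (h := norm_scal b (scal a x)).
  rewrite scal_assoc, hba, scal_one in h.
  assert (ha0 := abs_ge_0 a).
  apply Rmult_le_compat_l with (r := abs a) in h; [|assumption].
  replace (abs a * (abs b * norm (scal a x)))
    with ((abs b * abs a) * norm (scal a x)) in h by ring.
  now rewrite hab, Rmult_1_l in h.
Qed.

Lemma op_norm_finite (F : AbsRing) (X Y : NormedModule F) (L : X -> Y)
    (hL : is_linear L) : exists m : R, op_norm L = Finite m.
Proof.
unfold op_norm.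
match goal with |- context [Lub_Rbar ?E] => destruct (Lub_Rbar_correct E)
  as [hub hlub]; destruct (Lub_Rbar E) as [m | |] end.
- now exists m.
- destruct (linear_norm L hL) as [M [hM hb]].
  destruct (hlub (Finite M)).
  intros r [x [hx ->]]; simpl.
  assert (h := hb x); assert (M * norm x <= M * 1).
  { apply Rmult_le_compat_l; lra. }
  lra.
- destruct (hub (norm (L zero))).
  exists zero; rewrite norm_zero; split; [lra | reflexivity].
Qed.

Lemma norm_le_op_norm (F : AbsRing) (hF : real_or_complex F)
    (X Y : NormedModule F) (L : X -> Y) (hL : is_linear L) (B : R) :
  Rbar_le (op_norm L) B -> forall x, norm (L x) <= B * norm x.
Proof.
intros hB x.
destruct (Req_dec (norm x) 0) as [h0 | h0].
- rewrite h0, (norm_eq_zero x h0), (linear_zero L hL), norm_zero; lra.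
- destruct (real_line_embedding_exists F hF) as [iota [_ [_ habs]]].
  assert (hx : 0 < norm x) by (assert (h := norm_ge_0 x); lra).
  assert (hi : abs (iota (/ norm x)) = / norm x).
  { rewrite habs; apply Rabs_pos_eq; left; now apply Rinv_0_lt_compat. }
  assert (h : Rbar_le (norm (L (scal (iota (/ norm x)) x))) B).
  { eapply Rbar_le_trans; [|exact hB].
    apply (proj1 (Lub_Rbar_correct _)).
    eexists; split; [|reflexivity].
    rewrite (norm_scal_eq F hF), hi; right; now field. }
  simpl in h.
  rewrite (linear_scal L hL), (norm_scal_eq F hF), hi in h.
  apply Rmult_le_compat_l with (r := norm x) in h; [|lra].
  replace (norm x * (/ norm x * norm (L x))) with (norm (L x)) in h
    by now field.
  lra.
Qed.

Lemma is_linear_power (F : AbsRing) (X : NormedModule F) (T : X -> X)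
    (hT : is_linear T) (n : nat) : is_linear (power T n).
Proof.
induction n as [|n IH].
- apply is_linear_id.
- exact (is_linear_comp _ _ IH hT).
Qed.

Lemma power_bounded_orbit (F : AbsRing) (hF : real_or_complex F)
    (X : NormedModule F) (T : X -> X) (hT : is_linear T)
    (ha : power_bounded T) (y : X) :
  exists B : R, forall n, norm (power T n y) <= B.
Proof.
unfold power_bounded in ha.
assert (hub := proj1 (is_sup_seq_lub _ _
  (Sup_seq_correct (fun n => op_norm (power T n))))).
assert (hC : exists C : R, forall n, Rbar_le (op_norm (power T n)) C).
{ destruct (Sup_seq (fun n => op_norm (power T n))) as [C | |].
  - exists C; intros n; apply hub; now exists n.
  - destruct ha.
  - exists 0; intros n; eapply Rbar_le_trans; [apply hub; now exists n | easy]. }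
destruct hC as [C hC].
exists (C * norm y); intros n.
now apply norm_le_op_norm; [| apply is_linear_power |].
Qed.

(** * Subsequences *)

Lemma filterlim_strictly_increasing (s : nat -> nat) :
  strictly_increasing s -> filterlim s eventually eventually.
Proof. exact (eventually_subseq s). Qed.

Lemma strictly_increasing_comp (s t : nat -> nat) :
  strictly_increasing s -> strictly_increasing t ->
  strictly_increasing (fun k => s (t k)).
Proof.
intros hs ht k.
assert (hmono : forall i d, (s i < s (S d + i))%nat).
{ intros i d; induction d as [|d IH].
  - apply hs.
  - assert (h := hs (S d + i)%nat); simpl in *; lia. }
specialize (ht k).
replace (t (S k)) with (S (t (S k) - S (t k)) + t k)%nat by lia.
apply hmono.
Qed.

Lemma bounded_seq_convergent_subseq (u : nat -> R) (B : R) :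
  (forall n, 0 <= u n <= B) ->
  exists (s : nat -> nat) (l : R),
    strictly_increasing s /\ is_lim_seq (fun k => u (s k)) l.
Proof.
intros hu.
destruct (Bolzano_Weierstrass u _ (compact_P3 0 B) hu) as [l hl].
assert (hnext : forall Nk : nat * nat, exists p : nat,
  (fst Nk <= p)%nat /\ Rabs (u p - l) < / INR (S (snd Nk))).
{ intros [N k]; simpl fst; simpl snd.
  assert (hpos : 0 < / INR (S k)).
  { apply Rinv_0_lt_compat, lt_0_INR; lia. }
  apply (hl (fun z => Rabs (z - l) < / INR (S k)) N).
  exists (mkposreal _ hpos); now intros z hz. }
destruct (functional_choice _ hnext) as [next hnext'].
pose (s := fix s k := match k with
                      | O => next (O, O)
                      | S j => next (S (s j), S j)
                      end).
exists s, l; split.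
- intros k; apply (hnext' (S (s k), S k)).
- apply is_lim_seq_spec; intros eps.
  destruct (archimed_cor1 eps (cond_pos eps)) as [N [hN hN0]].
  exists N; intros k hk.
  assert (hs : Rabs (u (s k) - l) < / INR (S k)).
  { destruct k as [|k]; [apply (hnext' (O, O)) | apply (hnext' (S (s k), S k))]. }
  assert (/ INR (S k) <= / INR N).
  { apply Rinv_le_contravar; [now apply lt_0_INR | apply le_INR; lia]. }
  lra.
Qed.

Lemma LimInf_seq_nonneg_pos (u : nat -> R) :
  (forall n, 0 <= u n) -> LimInf_seq u <> Finite 0 ->
  exists c, 0 < c /\ exists N, forall n, (N <= n)%nat -> c <= u n.
Proof.
intros hu hne; apply NNPP; intros hno; apply hne.
apply is_LimInf_seq_unique; intros eps; assert (he := cond_pos eps); split.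
- intros N; apply NNPP; intros hN; apply hno.
  exists eps; split; [assumption|]; exists N; intros n hn.
  apply Rnot_lt_le; intros hlt; apply hN; exists n; split; [assumption | lra].
- exists O; intros n _; specialize (hu n); lra.
Qed.

(** * Radon-Riesz spaces *)

Lemma continuity_norm_line (F : AbsRing) (hF : real_or_complex F)
    (X : NormedModule F) (iota : R -> F) (hi : real_line_embedding F iota)
    (x w : X) : continuity (fun s => norm (plus x (scal (iota s) w))).
Proof.
destruct hi as [_ [hminus habs]]; intros t.
apply continuity_pt_filterlim, filterlim_locally; intros eps.
assert (hw := norm_ge_0 w).
assert (hpos : 0 < eps / (norm w + 1)).
{ apply Rdiv_lt_0_compat; [apply cond_pos | lra]. }
exists (mkposreal _ hpos); intros s hs.
change (Rabs (norm (plus x (scal (iota s) w))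
              - norm (plus x (scal (iota t) w))) < eps).
change (Rabs (s - t) < eps / (norm w + 1)) in hs.
eapply Rle_lt_trans; [apply norm_triangle_inv|].
replace (minus (plus x (scal (iota s) w)) (plus x (scal (iota t) w)))
  with (scal (iota (s - t)) w).
- rewrite (norm_scal_eq F hF), habs.
  apply Rle_lt_trans with (Rabs (s - t) * (norm w + 1)).
  + apply Rmult_le_compat_l; [apply Rabs_pos | lra].
  + apply Rmult_lt_compat_r with (r := norm w + 1) in hs; [|lra].
    unfold Rdiv in hs; rewrite Rmult_assoc, Rinv_l, Rmult_1_r in hs; lra.
- rewrite hminus.
  etransitivity; [exact (scal_minus_distr_r (iota s) (iota t) w)|].
  symmetry; apply minus_plus_plus_l.
Qed.

(** By the triangle inequality a displacement of size at least [2 ||x||] takes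
    [x] to a vector of norm at least [||x||].  Stretching [w] by [2 ||x|| / d]
    gives it that size, so the intermediate value theorem applies. *)
Lemma stretch_to_sphere (F : AbsRing) (hF : real_or_complex F)
    (X : NormedModule F) (iota : R -> F) (hi : real_line_embedding F iota)
    (x w : X) (d : R) :
  0 < d -> d <= norm w -> norm (plus x w) <= norm x ->
  exists s, 1 <= s <= Rmax 1 (2 * norm x / d) /\
            norm (plus x (scal (iota s) w)) = norm x.
Proof.
intros hd hw hin.
set (M := Rmax 1 (2 * norm x / d)).
assert (hM1 : 1 <= M) by apply Rmax_l.
assert (hMx : 2 * norm x <= M * norm w).
{ apply Rle_trans with (M * d).
  - replace (2 * norm x) with ((2 * norm x / d) * d) by (field; lra).
    apply Rmult_le_compat_r; [lra | apply Rmax_r].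
  - apply Rmult_le_compat_l; lra. }
set (h := fun s => norm (plus x (scal (iota s) w))).
assert (h1 : h 1 <= norm x).
{ unfold h; now rewrite (proj1 hi), scal_one. }
assert (hM : norm x <= h M).
{ assert (htri := norm_triangle (plus x (scal (iota M) w)) (opp x)).
  replace (plus (plus x (scal (iota M) w)) (opp x)) with (scal (iota M) w)
    in htri.
  - rewrite (norm_scal_eq F hF), norm_opp, (proj2 (proj2 hi)), Rabs_pos_eq
      in htri by lra.
    unfold h; lra.
  - symmetry; apply minus_plus_l. }
destruct (IVT_gen h 1 M (norm x)) as [s [hs hsx]].
- now apply continuity_norm_line.
- rewrite Rmin_left, Rmax_right; lra.
- exists s; split; [|exact hsx].
  now rewrite Rmin_left, Rmax_right in hs by assumption.
Qed.

Lemma weakly_converges_stretch (F : AbsRing) (X : NormedModule F)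
    (u : nat -> X) (x : X) (a : nat -> F) (M : R) :
  weakly_converges u x -> (forall k, abs (a k) <= M) ->
  weakly_converges (fun k => plus x (scal (a k) (minus (u k) x))) x.
Proof.
intros hu ha g hg.
assert (hM : 0 <= M) by exact (Rle_trans _ _ _ (abs_ge_0 (a O)) (ha O)).
apply filterlim_locally; intros eps.
assert (hpos : 0 < eps / (M + 1)).
{ apply Rdiv_lt_0_compat; [apply cond_pos | lra]. }
assert (h := proj1 (filterlim_locally _ _) (hu g hg) (mkposreal _ hpos)).
revert h; apply filter_imp; intros k hk.
change (abs (minus (g (u k)) (g x)) < eps / (M + 1)) in hk.
change (abs (minus (g (plus x (scal (a k) (minus (u k) x)))) (g x)) < eps).
replace (minus (g (plus x (scal (a k) (minus (u k) x)))) (g x))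
  with (mult (a k) (minus (g (u k)) (g x))).
- eapply Rle_lt_trans; [apply abs_mult|].
  apply Rle_lt_trans with ((M + 1) * abs (minus (g (u k)) (g x))).
  + apply Rmult_le_compat_r; [apply abs_ge_0 | specialize (ha k); lra].
  + apply Rmult_lt_compat_l with (r := M + 1) in hk; [|lra].
    replace (eps : R) with ((M + 1) * (eps / (M + 1))) by (field; lra).
    exact hk.
- rewrite (linear_plus g hg), (linear_scal g hg).
  change (minus (u k) x) with (plus (u k) (opp x)).
  rewrite (linear_plus g hg), (linear_opp g x hg).
  symmetry; apply minus_plus_l.
Qed.

(** The case [r < ||x||] cannot occur: there [||u_k - x||] is bounded below, and
    stretching the displacements onto the sphere of radius [||x||] would
    contradict the Radon-Riesz property. *)
Lemma type1_norm_converges (F : AbsRing) (hF : real_or_complex F)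
    (X : NormedModule F) (hX : type1 X) (u : nat -> X) (x : X) (r : R) :
  weakly_converges u x -> is_lim_seq (fun k => norm (u k)) r ->
  r <= norm x -> norm_converges u x.
Proof.
intros hu hr hle.
destruct (Rle_lt_or_eq_dec _ _ hle) as [hlt | ->]; [exfalso | now apply hX].
destruct (real_line_embedding_exists F hF) as [iota hi].
set (d := (norm x - r) / 2).
assert (hd : 0 < d) by (unfold d; lra).
set (M := Rmax 1 (2 * norm x / d)).
assert (hM1 : 1 <= M) by apply Rmax_l.
destruct (proj2 (is_lim_seq_spec _ _) hr (mkposreal _ hd)) as [N hN].
assert (hfar : forall k, (N <= k)%nat ->
  d <= norm (minus (u k) x) /\ norm (u k) <= norm x).
{ intros k hk; specialize (hN k hk); simpl in hN.
  apply Rabs_def2 in hN.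
  assert (htri := norm_triangle_inv (u k) x).
  rewrite Rabs_minus_sym in htri.
  assert (h := Rle_abs (norm x - norm (u k))).
  unfold d in *; lra. }
assert (hs : forall k, exists s, 1 <= s <= M /\ ((N <= k)%nat ->
  norm (plus x (scal (iota s) (minus (u k) x))) = norm x)).
{ intros k; destruct (Nat.le_gt_cases N k) as [hk | hk].
  - destruct (hfar k hk) as [h1 h2].
    destruct (stretch_to_sphere F hF X iota hi x (minus (u k) x) d)
      as [s [hs hsx]]; try assumption.
    + replace (plus x (minus (u k) x)) with (u k); [assumption|].
      symmetry; exact (plus_minus_r (NormedModule.AbelianGroup F X) x (u k)).
    + now exists s.
  - exists 1; split; [lra | lia]. }
destruct (functional_choice _ hs) as [s hs'].
set (v := fun k => plus x (scal (iota (s k)) (minus (u k) x))).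
assert (habs : forall k, abs (iota (s k)) = s k).
{ intros k; rewrite (proj2 (proj2 hi)).
  apply Rabs_pos_eq; destruct (hs' k); lra. }
assert (hv : norm_converges v x).
{ apply hX; split.
  - apply weakly_converges_stretch with M; [assumption|].
    intros k; rewrite habs; apply hs'.
  - apply is_lim_seq_ext_loc with (fun _ => norm x); [|apply is_lim_seq_const].
    exists N; intros k hk; symmetry; now apply hs'. }
destruct (hv _ (locally_ball_norm x (mkposreal _ hd))) as [N' hN'].
set (k := (N + N')%nat).
assert (hk := hN' k ltac:(unfold k; lia)); unfold ball_norm in hk; simpl in hk.
destruct (hfar k ltac:(unfold k; lia)) as [hdk _].
replace (minus (v k) x) with (scal (iota (s k)) (minus (u k) x)) in hk.
- rewrite (norm_scal_eq F hF), habs in hk.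
  destruct (hs' k) as [[hsk _] _].
  assert (1 * norm (minus (u k) x) <= s k * norm (minus (u k) x)).
  { apply Rmult_le_compat_r; lra. }
  lra.
- symmetry; apply minus_plus_l.
Qed.

(** * Supercyclicity when both alternatives fail *)

(** Along a sequence on which [f] asymptotically attains its bound [m] and stays
    away from [0], weak convergence of scalar multiples bounds the limit of their
    norms: [|f(x)|] is both the limit of [|a_k| L = |a_k| m b] and at most
    [m ||x||]. *)
Lemma type1_norm_converges_of_attained (F : AbsRing) (hF : real_or_complex F)
    (X : NormedModule F) (hX : type1 X) (f : X -> F) (hf : in_dual f)
    (a : nat -> F) (z : nat -> X) (x : X) (m b L : R) :
  (forall w, abs (f w) <= m * norm w) ->
  weakly_converges (fun k => scal (a k) (z k)) x ->
  is_lim_seq (fun k => norm (z k)) b ->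
  is_lim_seq (fun k => abs (f (z k))) L ->
  0 < L -> m * b <= L ->
  norm_converges (fun k => scal (a k) (z k)) x.
Proof.
intros hm hw hb hL hL0 hmb.
assert (hLmb : L = m * b).
{ apply Rle_antisym; [|exact hmb].
  apply (is_lim_seq_le _ _ (Finite L) (Finite (m * b)) (fun k => hm (z k)));
    [exact hL | exact (is_lim_seq_scal_l _ m b hb)]. }
assert (hb0 : 0 <= b).
{ apply (is_lim_seq_le (fun _ => 0) _ (Finite 0) (Finite b)
    (fun k => norm_ge_0 (z k))); [apply is_lim_seq_const | exact hb]. }
assert (hb1 : 0 < b).
{ destruct hb0 as [|<-]; [assumption | rewrite Rmult_0_r in hLmb; lra]. }
assert (hm0 : 0 < m).
{ apply Rmult_lt_reg_r with b; [assumption | lra]. }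
assert (hfx : is_lim_seq (fun k => abs (a k) * abs (f (z k))) (abs (f x))).
{ apply is_lim_seq_ext with (fun k => abs (f (scal (a k) (z k)))).
  - intros k; rewrite (linear_scal f hf).
    exact (norm_scal_eq F hF (AbsRing_NormedModule F) (a k) (f (z k))).
  - exact (filterlim_comp _ _ _ _ _ _ _ _ (hw f hf)
      (filterlim_norm (V := AbsRing_NormedModule F) (f x))). }
assert (hquot : is_lim_seq
  (fun k => abs (a k) * abs (f (z k)) / abs (f (z k)) * norm (z k))
  (abs (f x) / L * b)).
{ apply is_lim_seq_mult'; [|exact hb].
  apply is_lim_seq_div'; [exact hfx | exact hL | lra]. }
apply (type1_norm_converges F hF X hX) with (r := abs (f x) / L * b).
- exact hw.
- revert hquot; apply is_lim_seq_ext_loc.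
  destruct (proj2 (is_lim_seq_spec _ _) hL (mkposreal _ hL0)) as [N hN].
  exists N; intros k hk; specialize (hN k hk); simpl in hN.
  apply Rabs_def2 in hN.
  rewrite (norm_scal_eq F hF); field; lra.
- rewrite hLmb.
  replace (abs (f x) / (m * b) * b) with (abs (f x) / m) by (field; lra).
  apply Rmult_le_reg_l with m; [assumption|].
  replace (m * (abs (f x) / m)) with (abs (f x)) by (field; lra).
  apply hm.
Qed.

Theorem theorem5p1 (F : AbsRing) (hF : real_or_complex F)
    (X : NormedModule F) (hdim : infinite_dimensional X) (hX : type1 X)
    (T : X -> X) (hT : is_bounded_operator T) (y : X)
    (ha : power_bounded T)
    (hb : weakly_l_sequentially_supercyclic_vector T y)
    (hc : ~ supercyclic_vector T y) :
  forall f : X -> F, in_dual f -> (exists x : X, f x <> zero) ->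
    LimInf_seq (fun n => abs (f (power T n y))) = Finite 0
    \/
    (exists s : nat -> nat,
       strictly_increasing s /\
       Rbar_lt (LimSup_seq (fun k => abs (f (power T (s k) y))))
               (Rbar_mult (dual_norm f)
                          (LimSup_seq (fun k => norm (power T (s k) y))))).
Proof.
intros f hf _.
destruct (classic (LimInf_seq (fun n => abs (f (power T n y))) = Finite 0))
  as [hinf | hinf]; [now left | right].
apply NNPP; intros hno; apply hc; intros x eps.
destruct (LimInf_seq_nonneg_pos _ (fun n => abs_ge_0 _) hinf)
  as [c [hc0 [N hcN]]].
destruct (op_norm_finite F X (AbsRing_NormedModule F) f hf) as [m hm].
assert (hfm : forall w, abs (f w) <= m * norm w).
{ apply (norm_le_op_norm F hF X (AbsRing_NormedModule F) f hf).
  rewrite hm; apply Rbar_le_refl. }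
destruct (power_bounded_orbit F hF X T hT ha y) as [B hB].
destruct (linear_norm f hf) as [C [hC0 hC]].
destruct (proj2 hb x) as [a [s [_ [hs hw]]]].
destruct (bounded_seq_convergent_subseq (fun k => norm (power T (s k) y)) B)
  as [t1 [b [ht1 hlim1]]].
{ intros n; split; [apply norm_ge_0 | apply hB]. }
destruct (bounded_seq_convergent_subseq
  (fun k => abs (f (power T (s (t1 k)) y))) (C * B)) as [t2 [L [ht2 hlimL]]].
{ intros n; split; [apply abs_ge_0|].
  eapply Rle_trans; [apply hC|].
  apply Rmult_le_compat_l; [lra | apply hB]. }
set (t := fun k => t1 (t2 k)).
change (is_lim_seq (fun k => abs (f (power T (s (t k)) y))) L) in hlimL.
assert (ht := strictly_increasing_comp t1 t2 ht1 ht2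
  : strictly_increasing t).
assert (hst := strictly_increasing_comp s t hs ht).
assert (hlimb : is_lim_seq (fun k => norm (power T (s (t k)) y)) b).
{ exact (is_lim_seq_subseq _ _ t2 (filterlim_strictly_increasing t2 ht2) hlim1). }
assert (hcL : c <= L).
{ apply (is_lim_seq_le_loc (fun _ => c)
    (fun k => abs (f (power T (s (t k)) y))) (Finite c) (Finite L));
    [| apply is_lim_seq_const | exact hlimL].
  apply (filterlim_strictly_increasing _ hst
    (fun n => c <= abs (f (power T n y)))).
  exists N; exact hcN. }
assert (hmb : m * b <= L).
{ apply Rnot_lt_le; intros hlt; apply hno; exists (fun k => s (t k)).
  split; [exact hst|].
  rewrite (is_LimSup_seq_unique _ _ (is_lim_LimSup_seq _ _ hlimL)).
  rewrite (is_LimSup_seq_unique _ _ (is_lim_LimSup_seq _ _ hlimb)).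
  unfold dual_norm; rewrite hm; exact hlt. }
assert (hconv : norm_converges
  (fun k => scal (a (t k)) (power T (s (t k)) y)) x).
{ apply (type1_norm_converges_of_attained F hF X hX f hf
    (fun k => a (t k)) (fun k => power T (s (t k)) y) x m b L);
    try assumption; [| lra].
  intros g hg.
  exact (filterlim_comp _ _ _ _ _ _ _ _
    (filterlim_strictly_increasing t ht) (hw g hg)). }
destruct (hconv _ (locally_ball_norm x eps)) as [K hK].
exists (scal (a (t K)) (power T (s (t K)) y)); split.
- now exists (a (t K)), (s (t K)).
- exact (hK K (le_n K)).
Qed.
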